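(* Let $G$ be a countable group and let $A$ be a finite-dimensional vector space over a field $K$. Then the following conditions are equivalent: (a) every linear subshift $\Sigma \subset A^G$ is a subshift of finite type (SFT); (b) $A^G$ satisfies the descending chain condition for linear subshifts, that is, every decreasing sequence of linear subshifts of $A^G$ $$\Sigma_0 \supset \Sigma_1 \supset \cdots \supset \Sigma_n \supset \Sigma_{n+1} \supset \cdots$$ eventually stabilizes.
   Context: $A^G$ is the $K$-vector space of all maps $x \colon G \to A$, equipped with the prodiscrete topology (product topology with each factor $A$ discrete) and with the shift action of $G$ given by $(gx)(h) = x(g^{-1}h)$. A linear subshift of $A^G$ is a closed $G$-invariant vector subspace of $A^G$. A subset $\Sigma \subset A^G$ is a subshift of finite type (SFT) if there exist a finite subset $D \subset G$ and a subset $P \subset A^D$ such that $\Sigma = \{x \in A^G : (g^{-1}x)|_D \in P \text{ for all } g \in G\}$. A decreasing sequence $(\Sigma_n)_{n \in \mathbb{N}}$ eventually stabilizes if there exists $n_0$ such that $\Sigma_n = \Sigma_{n_0}$ for all $n \geq n_0$. *)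

(* Defs.v *)
From HB Require Import structures.
From mathcomp Require Import all_boot all_order all_algebra.
From mathcomp Require Import finmap.
From mathcomp Require Import all_classical topology.

Set Implicit Arguments.
Unset Strict Implicit.
Unset Printing Implicit Defensive.

Import GRing.Theory.
Local Open Scope classical_set_scope.

(* [G -> A] carries the pointwise [K]-module structure of [functions.v], but
   no canonical topology: the prodiscrete one is selected by [prodiscrete]. *)
Definition prodiscrete (G : Type) (A : choiceType) : topologicalType :=
  {ptws G -> discrete_topology A}.

Definition gshift (G : groupType) (A : Type) (g : G) (x : G -> A) : G -> A :=
  fun h => x (g^-1 * h)%g.

Definition restriction (G : choiceType) (A : Type) (D : {fset G})
    (x : G -> A) : D -> A :=
  fun d => x (val d).
Arguments restriction {G A} D x _.

Definition linear_subshift (G : groupType) (K : fieldType) (A : vectType K)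
    (Sigma : set (G -> A)) : Prop :=
  [/\ closed (Sigma : set (prodiscrete G A)),
      forall (g : G) (x : G -> A), Sigma x -> Sigma (gshift g x) &
      submod_closed (mem Sigma)].

Definition SFT (G : groupType) (A : Type) (Sigma : set (G -> A)) : Prop :=
  exists (D : {fset G}) (P : set (D -> A)),
    Sigma = [set x | forall g : G, P (restriction D (gshift g^-1%g x))].

Definition decreasing (T : Type) (Sigma : nat -> set T) : Prop :=
  forall n : nat, Sigma n.+1 `<=` Sigma n.

Definition eventually_stabilizes (T : Type) (Sigma : nat -> set T) : Prop :=
  exists n0 : nat, forall n : nat, (n0 <= n)%N -> Sigma n = Sigma n0.

(* Main.v *)
Require Import Defs.
From HB Require Import structures.
From mathcomp Require Import all_boot all_order all_algebra.
From mathcomp Require Import finmap.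
From mathcomp Require Import all_classical topology.

(** A closed set [S] is the intersection of the cylinders over its restrictions
    to finite windows.  If [S] is a linear subshift, the subshifts of finite
    type allowing exactly the patterns of [S] on larger and larger windows
    decrease to [S], so the chain condition makes [S] one of them.  Conversely,
    the patterns on a fixed window of a decreasing sequence of linear subshifts
    form a decreasing sequence of subspaces of a finite-dimensional space, which
    stabilizes; by a Mittag-Leffler argument along an exhaustion of [G], every
    stable pattern extends to an element of the intersection of the sequence.
    If that intersection is of finite type with window [D], it therefore
    contains every term whose patterns on [D] are the stable ones. *)

Set Implicit Arguments.
Unset Strict Implicit.
Unset Printing Implicit Defensive.

Import GRing.Theory.
Local Open Scope classical_set_scope.

Section DecreasingSequences.
Variables (T : Type) (S : nat -> set T).
Hypothesis decS : decreasing S.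

Lemma decreasing_homo : {homo S : m n / (m <= n)%N >-> n `<=` m}.
Proof.
apply: homo_leq decS => [X|Y X Z YX ZY]; first exact: subset_refl.
exact: subset_trans YX.
Qed.

Lemma eventually_stabilizesP :
  eventually_stabilizes S <-> exists N, S N `<=` \bigcap_n S n.
Proof.
split=> -[N SN]; exists N.
  move=> x SNx n _; have [leNn|/ltnW lenN] := leqP N n; first by rewrite SN.
  exact: decreasing_homo lenN _ SNx.
move=> n leNn; apply/seteqP; split; first exact: decreasing_homo.
by move=> x /SN; apply.
Qed.

End DecreasingSequences.

Section SubmodClosed.
Variable R : pzRingType.
Implicit Types U V : lmodType R.

Lemma submod_closed_setP V (S : set V) :
  submod_closed (mem S) <->
  S 0%R /\ forall (a : R) (u v : V), S u -> S v -> S (a *: u + v)%R.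
Proof.
split=> -[S0 SD]; split.
- by rewrite inE in S0.
- by move=> a u v Su Sv; have := SD a u v; rewrite !inE; apply.
- by rewrite inE.
- by move=> a u v; rewrite !inE; apply: SD.
Qed.

Lemma submod_closed_bigcap V (I : Type) (P : set I) (F : I -> set V) :
  (forall i, P i -> submod_closed (mem (F i))) ->
  submod_closed (mem (\bigcap_(i in P) F i)).
Proof.
move=> submodF; apply/submod_closed_setP; split=> [i Pi|a u v Fu Fv i Pi];
  have /submod_closed_setP[F0 FD] := submodF i Pi => //.
by apply: FD; [apply: Fu | apply: Fv].
Qed.

Lemma submod_closed_image U V (f : {linear U -> V}) (S : set U) :
  submod_closed (mem S) -> submod_closed (mem (f @` S)).
Proof.
move=> /submod_closed_setP[S0 SD]; apply/submod_closed_setP; split.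
  by exists 0%R => //; rewrite linear0.
move=> a _ _ [u Su <-] [v Sv <-].
by exists (a *: u + v)%R; [apply: SD | rewrite linearP].
Qed.

Lemma submod_closed_preimage U V (f : {linear U -> V}) (S : set V) :
  submod_closed (mem S) -> submod_closed (mem (f @^-1` S)).
Proof.
move=> /submod_closed_setP[S0 SD]; apply/submod_closed_setP; split.
  by rewrite /= linear0.
by move=> a u v Su Sv; rewrite /= linearP; apply: SD.
Qed.

End SubmodClosed.

Section Subspaces.
Variables (K : fieldType) (V : vectType K).

(* [S] contains a subspace of maximal dimension; adding to it the line of an
   element of [S] cannot increase its dimension. *)
Lemma submod_closed_vspace (S : set V) :
  submod_closed (mem S) -> exists U : {vspace V}, S = [set` U].
Proof.
move=> /submod_closed_setP[S0 SD].
pose is_dim k := `[< exists2 U : {vspace V}, [set` U] `<=` S & \dim U = k >].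
have dim0 : exists k, is_dim k.
  exists 0%N; apply/asboolP; exists 0%VS; last exact: dimv0.
  by move=> v /=; rewrite memv0 => /eqP ->.
have dim_bound k : is_dim k -> (k <= \dim {:V})%N.
  by move=> /asboolP[U _ <-]; apply/dimvS/subvf.
have [k /asboolP[U US dimU] maxk] := ex_maxnP dim0 dim_bound.
exists U; apply/seteqP; split=> // v Sv /=.
have addS : [set` (U + <[v]>)%VS] `<=` S.
  move=> _ /= /memv_addP[u uU [_ /vlineP[a ->] ->]].
  by rewrite addrC; apply: SD => //; apply: US.
have le_dim : (\dim (U + <[v]>) <= \dim U)%N.
  by rewrite dimU; apply: maxk; apply/asboolP; exists (U + <[v]>)%VS.
have /eqP -> : (U == U + <[v]>)%VS by rewrite eqEdim addvSl.
by apply: (subvP (addvSr _ _)); apply: memv_line.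
Qed.

Lemma submod_closed_stabilizes (S : nat -> set V) :
  (forall n, submod_closed (mem (S n))) -> decreasing S ->
  eventually_stabilizes S.
Proof.
move=> submodS decS.
have [U SU] := choice (fun n => submod_closed_vspace (submodS n)).
have dim0 : exists k, `[< exists n, \dim (U n) = k >].
  by exists (\dim (U 0%N)); apply/asboolP; exists 0%N.
have [k /asboolP[N dimN] mink] := ex_minnP dim0.
exists N => n leNn; rewrite !SU.
suff /eqP -> : U n == U N by [].
rewrite eqEdim dimN mink ?andbT; last by apply/asboolP; exists n.
apply/subvP => v Uv.
by have := decreasing_homo decS leNn (t := v); rewrite !SU; apply.
Qed.

End Subspaces.

Section Exhaustions.
Variable T : choiceType.
Implicit Types (D : {fset T}) (E : nat -> {fset T}).

Definition exhaustion E : Prop :=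
  {homo E : m n / (m <= n)%N >-> (m `<=` n)%fset} /\
  forall D, exists n, (D `<=` E n)%fset.

Lemma countable_exhaustion D :
  countable [set: T] -> exists2 E, exhaustion E & E 0%N = D.
Proof.
move=> /countable_injP[f f_inj].
have finE n : finite_set (f @^-1` `I_n).
  apply: finite_preimage (finite_II n) => x y _ _.
  by apply: f_inj; rewrite inE.
pose E n := (D `|` fset_set (f @^-1` `I_n))%fset.
have memE n x : (x \in E n) = (x \in D) || (f x < n)%N.
  by rewrite in_fsetU in_fset_set //; congr orb; apply/idP/idP; rewrite inE.
exists E; last by apply/fsetP => x; rewrite memE ltn0 orbF.
split=> [m n lemn|D'].
  apply/fsubsetP => x; rewrite !memE => /orP[->//|ltfm].
  by rewrite (leq_trans ltfm lemn) orbT.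
exists (\max_(x <- D') f x).+1; apply/fsubsetP => x xD'.
by rewrite memE ltnS leq_bigmax_seq ?orbT.
Qed.

Lemma glue_coherent (A : Type) E (X : nat -> T -> A) :
  exhaustion E -> (forall n, {in E n, X n =1 X n.+1}) ->
  exists y, forall n, {in E n, X n =1 y}.
Proof.
move=> [homoE coverE] XS.
have coherent m n t : (m <= n)%N -> t \in E m -> X m t = X n t.
  move=> /subnK <- tm; elim: (n - m)%N => [//|d ->].
  by rewrite addSn -XS //; apply: fsubsetP tm; rewrite homoE ?leq_addl.
have /choice[k tk] t : exists k, t \in E k.
  by have [k] := coverE [fset t]%fset; rewrite fsub1set; exists k.
exists (fun t => X (k t) t) => n t tn.
have [lenk|/ltnW lekn] := leqP n (k t); first exact: coherent.
exact/esym/coherent.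
Qed.

End Exhaustions.

Section Cylinders.
Variables (T : choiceType) (A : Type).
Implicit Types (D : {fset T}) (S : set (T -> A)) (x y : T -> A).

Definition pattern D x : {ffun D -> A} := finfun (restriction D x).

Definition cylinder D S : set (T -> A) := pattern D @^-1` (pattern D @` S).

Lemma patternP D x y : pattern D x = pattern D y <-> {in D, x =1 y}.
Proof.
split=> [/ffunP xy t tD|xy]; first by have := xy [` tD]%fset; rewrite !ffunE.
by apply/ffunP => d; rewrite !ffunE; apply/xy/valP.
Qed.

Lemma cylinderP D S x : cylinder D S x <-> exists2 y, S y & {in D, x =1 y}.
Proof.
split=> -[y Sy xy]; exists y => //; first exact/patternP.
exact/esym/patternP.
Qed.

Lemma sub_cylinder D S : S `<=` cylinder D S.
Proof. exact: preimage_image. Qed.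

Lemma cylinderS D S S' : S `<=` S' -> cylinder D S `<=` cylinder D S'.
Proof. by move=> SS'; apply: preimage_subset; apply: image_subset. Qed.

Lemma cylinder_absorb D S S' :
  S `<=` cylinder D S' -> cylinder D S `<=` cylinder D S'.
Proof. by move=> SS' x [y Sy xy]; rewrite /cylinder /= -xy; apply: SS'. Qed.

Lemma cylinder_fsubset D D' S :
  (D `<=` D')%fset -> cylinder D' S `<=` cylinder D S.
Proof.
move=> /fsubsetP DD' x /cylinderP[y Sy xy].
by apply/cylinderP; exists y => // t /DD'; apply: xy.
Qed.

Lemma decreasing_cylinder D (S : nat -> set (T -> A)) :
  decreasing S -> decreasing (fun n => cylinder D (S n)).
Proof. by move=> decS n; apply/cylinderS/decS. Qed.

Lemma cylinder_inverse_limit E (W : nat -> set (T -> A)) :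
  exhaustion E -> (forall n, W n `<=` cylinder (E n) (W n.+1)) ->
  W 0%N `<=` cylinder (E 0%N) (\bigcap_n cylinder (E n) (W n)).
Proof.
move=> exhE lift x Wx.
have /choice[F FP] (p : nat * (T -> A)) : exists y,
    W p.1 p.2 -> W p.1.+1 y /\ {in E p.1, p.2 =1 y}.
  have [/lift/cylinderP[y Wy py]|] := pselect (W p.1 p.2); first by exists y.
  by exists p.2.
pose X := fix X n := if n is m.+1 then F (m, X m) else x.
have WX n : W n (X n) by elim: n => // n /(FP (n, X n))[].
have [n|y Xy] := glue_coherent (X := X) exhE.
  by have [] := FP (n, X n) (WX n).
apply/cylinderP; exists y; last exact: (Xy 0%N).
move=> n _; apply/cylinderP; exists (X n); first exact: WX.
by move=> t tn; rewrite Xy.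
Qed.

End Cylinders.

Section Prodiscrete.
Variables T A : choiceType.
Implicit Types (D : {fset T}) (S : set (T -> A)) (x : T -> A).

Lemma nbhs_cylinder D x : nbhs (x : prodiscrete T A) (cylinder D [set x]).
Proof.
have nbhs_agree t : nbhs (x : prodiscrete T A) [set y : T -> A | y t = x t].
  exact: (@proj_continuous T (fun=> discrete_topology A) t x [set x t]
            (discrete_set1 (x t : discrete_topology A))).
rewrite (_ : cylinder D _ =
    \bigcap_(t in [set` D]) [set y : T -> A | y t = x t]).
  exact: filter_bigI.
apply/seteqP; split=> [y /cylinderP[_ -> xy] t /xy //|y xy].
by apply/cylinderP; exists x.
Qed.

Lemma nbhs_prodiscreteP x (U : set (T -> A)) :
  nbhs (x : prodiscrete T A) U <-> exists D, cylinder D [set x] `<=` U.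
Proof.
split=> [|[D]]; last by move/filterS; apply; apply: nbhs_cylinder.
pose F : set_system (prodiscrete T A) :=
  filter_from setT (fun D => cylinder D [set x]).
have filterF : Filter F.
  apply: filter_from_filter; first by exists fset0.
  move=> D D' _ _; exists (D `|` D')%fset => // y Dy.
  by split; apply: cylinder_fsubset Dy; rewrite ?fsubsetUl ?fsubsetUr.
have Fx : F --> (x : prodiscrete T A).
  apply/cvg_sup => t V [_ [[B _ <-] /= Bx BV]].
  exists [fset t]%fset => // y /cylinderP[_ -> xy]; apply: BV => /=.
  by rewrite xy ?inE.
by move=> /Fx[D _ DU]; exists D.
Qed.

Lemma closure_prodiscrete S :
  closure (S : set (prodiscrete T A)) = \bigcap_D cylinder D S.
Proof.
apply/seteqP; split=> x clSx.
  move=> D _; have [y [Sy /cylinderP[_ -> yx]]] := clSx _ (nbhs_cylinder D x).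
  by apply/cylinderP; exists y => // t tD; rewrite yx.
move=> U /nbhs_prodiscreteP[D DU]; have /cylinderP[y Sy xy] := clSx D I.
exists y; split=> //; apply/DU/cylinderP; exists x => // t tD.
by rewrite xy.
Qed.

Lemma closed_cylinder D S : closed (cylinder D S : set (prodiscrete T A)).
Proof.
rewrite /closed closure_prodiscrete => x /(_ D I).
exact: cylinder_absorb.
Qed.

Lemma bigcap_cylinder_exhaustion E S :
  exhaustion E -> closed (S : set (prodiscrete T A)) ->
  \bigcap_n cylinder (E n) S `<=` S.
Proof.
move=> [_ coverE] clS x Ex; apply: clS; rewrite closure_prodiscrete => D _.
by have [n Dn] := coverE D; apply: cylinder_fsubset Dn _ (Ex n I).
Qed.

(* Mittag-Leffler: along an exhaustion starting at [D], the patterns common to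
   all [S n] lift from each window to the next. *)
Lemma bigcap_cylinder D (S : nat -> set (T -> A)) :
  countable [set: T] ->
  (forall n, closed (S n : set (prodiscrete T A))) -> decreasing S ->
  (forall D', eventually_stabilizes (fun n => cylinder D' (S n))) ->
  \bigcap_n cylinder D (S n) `<=` cylinder D (\bigcap_n S n).
Proof.
move=> countT clS decS stabS.
have [E exhE <-] := countable_exhaustion D countT.
pose W k := \bigcap_n cylinder (E k) (S n).
have lift k : W k `<=` cylinder (E k) (W k.+1).
  have /(eventually_stabilizesP (decreasing_cylinder decS))[N SN] :=
    stabS (E k.+1).
  apply: subset_trans (bigcap_inf (i := N) I) (cylinderS _).
  by move=> y /sub_cylinder /SN.
apply: subset_trans (cylinder_inverse_limit exhE lift) _.
apply: cylinderS => y Wy n _; apply: (bigcap_cylinder_exhaustion exhE) => //.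
move=> k _; apply: cylinder_absorb (Wy k I).
exact: bigcap_inf.
Qed.

End Prodiscrete.

Section Shifts.
Variables (G : groupType) (A : Type).
Implicit Types (D : {fset G}) (S : set (G -> A)) (x : G -> A).

Lemma gshift1 x : gshift 1%g x = x.
Proof. by apply/funext => h; rewrite /gshift invg1 mul1g. Qed.

Lemma gshiftM g h x : gshift g (gshift h x) = gshift (g * h)%g x.
Proof. by apply/funext => k; rewrite /gshift invgM mulgA. Qed.

Definition shift_invariant S : Prop :=
  forall (g : G) x, S x -> S (gshift g x).

Definition sft_hull D S : set (G -> A) :=
  \bigcap_g gshift g^-1%g @^-1` cylinder D S.

Lemma sft_hull_shift_invariant D S : shift_invariant (sft_hull D S).
Proof.
move=> g x Sx h _; have := Sx (g^-1 * h)%g I.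
by rewrite /= gshiftM invgM invgK.
Qed.

Lemma sft_hull_sub_cylinder D S : sft_hull D S `<=` cylinder D S.
Proof. by move=> x /(_ 1%g I); rewrite /= invg1 gshift1. Qed.

Lemma sub_sft_hull D S S' :
  shift_invariant S -> S `<=` cylinder D S' -> S `<=` sft_hull D S'.
Proof. by move=> invS SS' x Sx g _; apply/SS'/invS. Qed.

Lemma sft_hull_fsubset D D' S :
  (D `<=` D')%fset -> sft_hull D' S `<=` sft_hull D S.
Proof. by move=> DD' x Sx g _; apply: cylinder_fsubset DD' _ (Sx g I). Qed.

Lemma decreasing_sft_hull E S :
  exhaustion E -> decreasing (fun n => sft_hull (E n) S).
Proof. by move=> [homoE _] n; apply/sft_hull_fsubset/homoE. Qed.

Lemma SFT_shift_invariant S : SFT S -> shift_invariant S.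
Proof.
move=> [D [P ->]] g x Px h; have := Px (g^-1 * h)%g.
by rewrite gshiftM invgM invgK.
Qed.

Lemma SFTP S : SFT S <-> exists D, S = sft_hull D S.
Proof.
split=> [sftS|[D ->]].
  have invS := SFT_shift_invariant sftS; have [D [P SE]] := sftS.
  exists D; apply/seteqP; split; first exact/(sub_sft_hull invS)/sub_cylinder.
  move=> x Sx; rewrite SE => g; have /cylinderP[y Sy xy] := Sx g I.
  have -> : restriction D (gshift g^-1%g x) = restriction D y.
    by apply/funext => d; apply/xy/valP.
  by move: Sy; rewrite SE => /(_ 1%g); rewrite invg1 gshift1.
exists D, [set p | (pattern D @` S) (finfun p)].
by apply/seteqP; split=> x Sx g; [apply: Sx | move=> _; apply: Sx].
Qed.

End Shifts.

Section Subshifts.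
Variables (G : groupType) (A : choiceType).
Implicit Types (D : {fset G}) (S : set (G -> A)) (x : G -> A).

Lemma continuous_gshift (g : G) :
  continuous (gshift g : prodiscrete G A -> prodiscrete G A).
Proof.
move=> x U /nbhs_prodiscreteP[D DU]; apply/nbhs_prodiscreteP.
exists [fset (g^-1 * h)%g | h in D]%fset => y /cylinderP[_ -> yx].
apply/DU/cylinderP; exists (gshift g x) => // h hD.
exact/yx/in_imfset.
Qed.

Lemma closed_sft_hull D S : closed (sft_hull D S : set (prodiscrete G A)).
Proof.
apply: (closed_bigI (T := prodiscrete G A)) => g _.
have /continuous_closedP := continuous_gshift (g := g^-1%g); apply.
exact: closed_cylinder.
Qed.

Lemma sft_hull_stabilizes_SFT (E : nat -> {fset G}) S :
  exhaustion E -> closed (S : set (prodiscrete G A)) -> shift_invariant S ->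
  eventually_stabilizes (fun n => sft_hull (E n) S) -> SFT S.
Proof.
move=> exhE clS invS.
move=> /(eventually_stabilizesP (decreasing_sft_hull exhE))[N HN].
apply/SFTP; exists (E N).
apply/seteqP; split; first exact/(sub_sft_hull invS)/sub_cylinder.
move=> x /HN Hx; apply: (bigcap_cylinder_exhaustion exhE clS) => n _.
exact: sft_hull_sub_cylinder (Hx n I).
Qed.

Lemma bigcap_SFT_stabilizes (S : nat -> set (G -> A)) :
  countable [set: G] ->
  (forall n, closed (S n : set (prodiscrete G A))) ->
  (forall n, shift_invariant (S n)) -> decreasing S ->
  (forall D, eventually_stabilizes (fun n => cylinder D (S n))) ->
  SFT (\bigcap_n S n) -> eventually_stabilizes S.
Proof.
move=> countG clS invS decS stabS /SFTP[D capE].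
have /(eventually_stabilizesP (decreasing_cylinder decS))[N SN] := stabS D.
apply/(eventually_stabilizesP decS); exists N; rewrite capE.
apply: sub_sft_hull (invS N) _ => x /(sub_cylinder D) /SN.
exact: bigcap_cylinder.
Qed.

End Subshifts.

Section LinearSubshifts.
Variables (G : groupType) (K : fieldType) (A : vectType K).
Implicit Types (D : {fset G}) (S : set (G -> A)).

Lemma pattern_is_linear D : linear (pattern D : (G -> A) -> {ffun D -> A}).
Proof. by move=> a x y; apply/ffunP => d; rewrite !ffunE. Qed.

HB.instance Definition _ D :=
  GRing.isLinear.Build K (G -> A) {ffun D -> A} *:%R (pattern D)
    (pattern_is_linear D).

Lemma gshift_is_linear (g : G) : linear (gshift g : (G -> A) -> (G -> A)).
Proof. by []. Qed.

HB.instance Definition _ (g : G) :=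
  GRing.isLinear.Build K (G -> A) (G -> A) *:%R (gshift g)
    (gshift_is_linear g).

Lemma linear_subshift_bigcap (I : Type) (P : set I) (F : I -> set (G -> A)) :
  (forall i, P i -> linear_subshift (F i)) ->
  linear_subshift (\bigcap_(i in P) F i).
Proof.
move=> linF; split.
- by apply: (closed_bigI (T := prodiscrete G A)) => i /linF[].
- by move=> g x Fx i Pi; have [_ invF _] := linF i Pi; apply/invF/Fx.
- by apply: submod_closed_bigcap => i /linF[].
Qed.

Lemma linear_subshift_sft_hull D S :
  linear_subshift S -> linear_subshift (sft_hull D S).
Proof.
move=> [_ _ submodS]; split.
- exact: closed_sft_hull.
- exact: sft_hull_shift_invariant.
- apply: submod_closed_bigcap => g _.
  by do 2!apply: submod_closed_preimage; apply: submod_closed_image.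
Qed.

Lemma linear_subshift_cylinder_stabilizes (S : nat -> set (G -> A)) :
  (forall n, linear_subshift (S n)) -> decreasing S ->
  forall D, eventually_stabilizes (fun n => cylinder D (S n)).
Proof.
move=> linS decS D.
have [n|n|N stab] := submod_closed_stabilizes (S := fun n => pattern D @` S n).
- by have [_ _] := linS n; apply: submod_closed_image.
- exact/image_subset/decS.
- by exists N => n /stab imE; rewrite /cylinder imE.
Qed.

End LinearSubshifts.

Theorem corollary1p2 (G : groupType) (countG : countable [set: G])
    (K : fieldType) (A : vectType K) :
  (forall Sigma : set (G -> A), linear_subshift Sigma -> SFT Sigma)
  <->
  (forall Sigma : nat -> set (G -> A),
     (forall n : nat, linear_subshift (Sigma n)) ->
     decreasing Sigma -> eventually_stabilizes Sigma).
Proof.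
split=> [sft S linS decS|dcc S linS].
  apply: bigcap_SFT_stabilizes => //.
  - by move=> n; have [] := linS n.
  - by move=> n; have [] := linS n.
  - exact: linear_subshift_cylinder_stabilizes.
  - exact/sft/linear_subshift_bigcap.
have [E exhE _] := countable_exhaustion fset0 countG.
have [clS invS _] := linS; apply: (sft_hull_stabilizes_SFT exhE) => //.
apply: dcc; last exact: decreasing_sft_hull.
by move=> n; apply: linear_subshift_sft_hull.
Qed.
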